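(* Let $\mathcal{A},\mathcal{Q}\in\mathbb{R}^{n\times n}$ be given symmetric matrices that satisfy $\mathcal{A}\mathbf{1}=\mathcal{Q}\mathbf{1}=0$, and suppose that $\mathcal{A}$ is negative definite when restricted to the subspace $\mathbf{1}^\perp$. For the Lyapunov equation in the unknown matrix $\mathcal{P}\in\mathbb{R}^{n\times n}$ $$\mathcal{A}^T\mathcal{P}+\mathcal{P}\mathcal{A}=-\mathcal{Q},\qquad(\ast)$$ the following statements hold. (i) If $\mathcal{P}$ is a solution of $(\ast)$, then so is $\mathcal{P}+\alpha\,\mathbf{1}\mathbf{1}^T$ for any $\alpha\in\mathbb{R}$. (ii) If $\mathcal{P}$ is a solution of $(\ast)$ and $\mathcal{Q}$ is positive semidefinite on $\mathbf{1}^\perp$, then $\mathbf{1}$ is an eigenvector of $\mathcal{P}$ and $\mathcal{P}$ is positive semidefinite on $\mathbf{1}^\perp$. Furthermore, among all $\mathcal{P}\succeq 0$ that satisfy $(\ast)$, the one with the minimum trace satisfies $\mathcal{P}\mathbf{1}=0$. (iii) Any solution $\mathcal{P}$ of $(\ast)$ satisfies $$\operatorname{trace}(\mathcal{P})=p-\tfrac12\operatorname{trace}(\mathcal{Q}\mathcal{A}^\dagger),\qquad \mathcal{P}=\tfrac{p}{n}\,\mathbf{1}\mathbf{1}^T+\mathcal{P}^\perp,$$ for some $p\in\mathbb{R}$ and matrix $\mathcal{P}^\perp$ with $\mathcal{P}^\perp\mathbf{1}=0$, where $p$ is independent of $\mathcal{A}$ and $\mathcal{Q}$. Additionally, if $\mathcal{Q}$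 is positive semidefinite on $\mathbf{1}^\perp$, then so is $\mathcal{P}^\perp$. (iv) The identity $$\operatorname{trace}(\mathcal{Q}\mathcal{A}^\dagger)=\operatorname{trace}\big(\mathcal{Q}(\mathcal{A}-\mathbf{1}\mathbf{1}^T/n)^{-1}\big)$$ holds, and any solution $\mathcal{P}$ of $(\ast)$ satisfies $$\operatorname{trace}(\mathcal{P})=p-\tfrac12\operatorname{trace}\big(\mathcal{Q}(\mathcal{A}-\mathbf{1}\mathbf{1}^T/n)^{-1}\big),$$ where $p\in\mathbb{R}$ is independent of $\mathcal{A}$ and $\mathcal{Q}$.
   Context: $\mathbf{1}\in\mathbb{R}^n$ is the column vector of all ones, and $\mathbf{1}^\perp=\{\zeta\in\mathbb{R}^n:\zeta^T\mathbf{1}=0\}$. A matrix $S\in\mathbb{R}^{n\times n}$ is positive semidefinite (respectively negative definite) on, or when restricted to, $\mathbf{1}^\perp$ if $\zeta^TS\zeta\ge 0$ (respectively $\zeta^TS\zeta<0$) for all nonzero $\zeta\in\mathbf{1}^\perp$. $\mathcal{P}\succeq 0$ means that $\mathcal{P}$ is symmetric positive semidefinite. $\mathcal{A}^\dagger$ is the Moore--Penrose pseudoinverse of $\mathcal{A}$. *)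

(* Defs.v *)
From mathcomp Require Import all_boot all_order all_algebra.
From mathcomp Require Import reals.

Set Implicit Arguments.
Unset Strict Implicit.
Unset Printing Implicit Defensive.

Import Order.TTheory GRing.Theory Num.Theory.
Local Open Scope ring_scope.

Definition ones (R : realType) (n : nat) : 'cV[R]_n := const_mx 1.
Arguments ones {R n}.

Definition qform (R : realType) (n : nat) (S : 'M[R]_n) (z : 'cV[R]_n) : R :=
  (z^T *m S *m z) 0 0.

Definition in_ones_perp (R : realType) (n : nat) (z : 'cV[R]_n) : Prop :=
  z^T *m ones = 0.

Definition psd_on_perp (R : realType) (n : nat) (S : 'M[R]_n) : Prop :=
  forall z : 'cV[R]_n, in_ones_perp z -> z != 0 -> 0 <= qform S z.

Definition negdef_on_perp (R : realType) (n : nat) (S : 'M[R]_n) : Prop :=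
  forall z : 'cV[R]_n, in_ones_perp z -> z != 0 -> qform S z < 0.

Definition psd (R : realType) (n : nat) (P : 'M[R]_n) : Prop :=
  P^T = P /\ forall z : 'cV[R]_n, 0 <= qform P z.

Definition lyapunov (R : realType) (n : nat) (A Q P : 'M[R]_n) : Prop :=
  A^T *m P + P *m A = - Q.

(* Eigenvectors are column vectors here, unlike the row vectors of
   [eigenspace]. *)
Definition is_eigenvector (R : realType) (n : nat) (P : 'M[R]_n)
    (v : 'cV[R]_n) : Prop :=
  v != 0 /\ exists a : R, P *m v = a *: v.

Definition min_trace_solution (R : realType) (n : nat) (A Q P : 'M[R]_n) :
    Prop :=
  [/\ lyapunov A Q P, psd P &
      forall P' : 'M[R]_n, lyapunov A Q P' -> psd P' -> \tr P <= \tr P'].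

(* The four Penrose equations; boolean so that [xchoose] applies. *)
Definition penrose (R : realType) (m n : nat) (A : 'M[R]_(m, n)) (X : 'M[R]_(n, m)) : bool :=
  [&& A *m X *m A == A, X *m A *m X == X,
      (A *m X)^T == A *m X & (X *m A)^T == X *m A].

Lemma gram_unit (R : realType) (m n : nat) (B : 'M[R]_(m, n)) :
  row_free B -> B *m B^T \in unitmx.
Proof.
move=> fB; rewrite -row_free_unit; apply/row_freeP.
have : kermx (B *m B^T) == 0.
  apply/rowV0P => v /sub_kermxP; rewrite mulmxA => h.
  have : (v *m B) *m (v *m B)^T = 0 by rewrite trmx_mul mulmxA h mul0mx.
  move/(congr1 (fun M : 'M_1 => M 0 0)); rewrite !mxE => h0.
  have vB0 : v *m B = 0.
    apply/rowP => j; rewrite [RHS]mxE.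
    have /psumr_eq0P/(_ h0 j isT) :
        forall k : 'I_n, true -> 0 <= (v *m B) 0 k * (v *m B)^T k 0.
      by move=> k _; rewrite [X in _ * X]mxE -expr2 sqr_ge0.
    by rewrite [X in _ * X]mxE -expr2 => /eqP; rewrite sqrf_eq0 => /eqP.
  by apply: (row_free_inj fB); rewrite vB0 mul0mx.
by rewrite kermx_eq0 => /row_freeP.
Qed.

Lemma penrose_full_rank_mul (R : realType) (m r n : nat)
    (C : 'M[R]_(m, r)) (F : 'M[R]_(r, n)) :
  row_free C^T -> row_free F -> exists X, penrose (C *m F) X.
Proof.
move=> /gram_unit; rewrite trmxK => uC /gram_unit uF.
pose iF := invmx (F *m F^T); pose iC := invmx (C^T *m C).
have siF : iF^T = iF by rewrite /iF trmx_inv trmx_mul trmxK.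
have siC : iC^T = iC by rewrite /iC trmx_inv trmx_mul trmxK.
pose X := F^T *m iF *m iC *m C^T.
have AX : C *m F *m X = C *m iC *m C^T.
  by rewrite /X !mulmxA -[C *m F *m F^T]mulmxA -[C *m _ *m iF]mulmxA
     mulmxV // mulmx1.
have XA : X *m (C *m F) = F^T *m iF *m F.
  by rewrite /X !mulmxA -[_ *m C^T *m C]mulmxA -[_ *m iC *m _]mulmxA
     mulVmx // mulmx1.
exists X; apply/and4P; split; apply/eqP.
- by rewrite AX mulmxA -[_ *m C^T *m C]mulmxA -[_ *m iC *m _]mulmxA
     mulVmx // mulmx1.
- by rewrite XA /X !mulmxA -[_ *m F *m F^T]mulmxA -[_ *m iF *m (_ *m _)]mulmxA
     mulVmx // mulmx1.
- by rewrite AX !trmx_mul trmxK siC mulmxA.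
- by rewrite XA !trmx_mul trmxK siF mulmxA.
Qed.

Lemma penrose_exists (R : realType) (m n : nat) (A : 'M[R]_(m, n)) :
  exists X, penrose A X.
Proof.
have [] := @penrose_full_rank_mul R _ _ _ (col_base A) (row_base A).
- by rewrite -row_leq_rank mxrank_tr col_leq_rank col_base_full.
- exact: row_base_free.
by move=> X; rewrite mulmx_base => AX; exists X.
Qed.

Definition mp_inverse (R : realType) (m n : nat) (A : 'M[R]_(m, n)) : 'M[R]_(n, m) :=
  xchoose (penrose_exists A).

Lemma mp_inverseP (R : realType) (m n : nat) (A : 'M[R]_(m, n)) : penrose A (mp_inverse A).
Proof. exact: xchooseP. Qed.

Lemma penrose_unique (R : realType) (m n : nat) (A : 'M[R]_(m, n)) (X Y : 'M[R]_(n, m)) :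
  penrose A X -> penrose A Y -> X = Y.
Proof.
case/and4P=> /eqP X1 /eqP X2 /eqP X3 /eqP X4.
case/and4P=> /eqP Y1 /eqP Y2 /eqP Y3 /eqP Y4.
have eAX : A *m X = A *m Y.
  rewrite -{1}Y1 -[A *m Y *m A *m X]mulmxA -Y3 -X3 -trmx_mul.
  by rewrite mulmxA X1.
have eXA : X *m A = Y *m A.
  rewrite -{1}Y1 -[A *m Y *m A]mulmxA mulmxA -X4 -Y4 -trmx_mul.
  by rewrite -mulmxA [A *m (X *m A)]mulmxA X1.
by rewrite -X2 eXA -mulmxA eAX mulmxA Y2.
Qed.

(* Main.v *)
(* Let J = 11^T/n. The matrix B = A - J is negative definite on the whole
   space and B^-1 + J is the pseudoinverse of A. The operator
   X |-> B X + X B is injective, since tr(X^T (B X + X B)) is a sum of values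
   of the form of B, so B X + X B = -Q has a unique solution X; it is symmetric
   with X 1 = 0, and its trace is -tr(Q B^-1)/2. The solutions of the Lyapunov
   equation for A are exactly the matrices c J + X, and p is the map
   P |-> tr(J P), which reads off c. Everything then reduces to X being
   positive semidefinite when Q is. *)
Require Import Defs.
From mathcomp Require Import all_boot all_order all_algebra.
From mathcomp Require Import reals.
From mathcomp Require Import classical_sets ring lra.
Import Order.TTheory GRing.Theory Num.Theory.
Local Open Scope ring_scope.

Set Implicit Arguments.
Unset Strict Implicit.
Unset Printing Implicit Defensive.

(** * Quadratic forms: norm bounds and coercivity *)

Section QuadraticForms.
Variables (R : realType) (n : nat).
Implicit Types (S T : 'M[R]_n) (y z : 'cV[R]_n).

Definition negdef S : Prop := forall z, z != 0 -> qform S z < 0.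

Lemma qformE S z : qform S z = \tr (z^T *m S *m z).
Proof. by rewrite /qform /mxtrace big_ord1. Qed.

Lemma qformD S T z : qform (S + T) z = qform S z + qform T z.
Proof. by rewrite !qformE mulmxDr mulmxDl raddfD. Qed.

Lemma qformN S z : qform (- S) z = - qform S z.
Proof. by rewrite !qformE mulmxN mulNmx raddfN. Qed.

Lemma qformZ a S z : qform (a *: S) z = a * qform S z.
Proof. by rewrite !qformE -scalemxAr -scalemxAl linearZ. Qed.

Lemma qform_scale S a z : qform S (a *: z) = a ^+ 2 * qform S z.
Proof.
rewrite !qformE [(a *: z)^T]linearZ /= -!scalemxAl -scalemxAr.
by rewrite scalerA linearZ.
Qed.

Lemma qform0 S : qform S 0 = 0.
Proof. by rewrite qformE mulmx0 mxtrace0. Qed.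

Lemma qform_sum S z : qform S z = \sum_i \sum_j z i 0 * S i j * z j 0.
Proof.
rewrite /qform mxE exchange_big; apply: eq_bigr => j _ /=.
by rewrite mxE mulr_suml; apply: eq_bigr => i _; rewrite !mxE.
Qed.

Lemma qform1E z : qform 1%:M z = \sum_i z i 0 ^+ 2.
Proof.
by rewrite /qform mulmx1 mxE; apply: eq_bigr => i _; rewrite !mxE expr2.
Qed.

Lemma qform1_ge0 z : 0 <= qform 1%:M z.
Proof. by rewrite qform1E; apply: sumr_ge0 => i _; apply: sqr_ge0. Qed.

Lemma qform1_gt0 z : z != 0 -> 0 < qform 1%:M z.
Proof.
move=> z0; rewrite lt_def qform1_ge0 andbT; apply: contra z0.
rewrite qform1E => /eqP /psumr_eq0P h; apply/eqP/colP => i; rewrite mxE.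
by apply/eqP; rewrite -sqrf_eq0; apply/eqP/h => // j _; apply: sqr_ge0.
Qed.

Lemma qform_bounded S : exists2 c, 0 < c &
  forall z, `|qform S z| <= c * qform 1%:M z.
Proof.
have h0 : 0 <= \sum_i \sum_j `|S i j|.
  by apply: sumr_ge0 => i _; apply: sumr_ge0.
(* The summand 1 keeps the constant positive even for [S = 0], so that it can be inverted later. *)
exists (1 + \sum_i \sum_j `|S i j|); first by rewrite ltr_wpDr.
move=> z.
apply: (@le_trans _ _ ((\sum_i \sum_j `|S i j|) * qform 1%:M z)); last first.
  by rewrite ler_wpM2r ?qform1_ge0 // lerDr.
have zi i : z i 0 ^+ 2 <= qform 1%:M z.
  rewrite qform1E (bigD1 i) //= lerDl.
  by apply: sumr_ge0 => j _; apply: sqr_ge0.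
rewrite qform_sum; apply: (le_trans (ler_norm_sum _ _ _)).
rewrite mulr_suml; apply: ler_sum => i _.
apply: (le_trans (ler_norm_sum _ _ _)).
rewrite mulr_suml; apply: ler_sum => j _.
rewrite mulrAC normrM mulrC; apply: ler_wpM2l => //.
(* What remains is [|z_i z_j| <= |z|^2]; after squaring it is the product of two instances of
   [zi]. *)
rewrite -[leRHS](ger0_norm (qform1_ge0 z)) -ler_sqr ?nnegrE //.
rewrite !real_normK ?num_real // exprMn [leRHS]expr2.
by apply: ler_pM => //; apply: sqr_ge0.
Qed.

Lemma qformB S y z : S^T = S ->
  qform S (y - z) = qform S y - 2 * \tr (z^T *m S *m y) + qform S z.
Proof.
move=> sS; rewrite !qformE [(y - z)^T]linearB /= !mulmxBl !mulmxBr !raddfB /=.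
have -> : \tr (y^T *m S *m z) = \tr (z^T *m S *m y).
  by rewrite -mxtrace_tr !trmx_mul trmxK sS mulmxA.
ring.
Qed.

(* Expand [0 <= qform S (z - s *: (invmx S *m z))] for a small [s]. *)
Lemma psd_unit_coercive S : psd S -> S \in unitmx ->
  exists2 e, 0 < e & forall z, e * qform 1%:M z <= qform S z.
Proof.
case=> sS S0 uS; have [c c0 hc] := qform_bounded (invmx S).
(* With [s = c^-1] the quadratic term is at most [s |z|^2], half of the cross term [2 s |z|^2]; the
   other half is the coercivity bound. *)
exists c^-1 => [|z]; first by rewrite invr_gt0.
have := S0 (z - c^-1 *: (invmx S *m z)).
rewrite (qformB _ _ sS) qform_scale.
have -> : qform S (invmx S *m z) = qform (invmx S) z.
  by rewrite !qformE trmx_mul trmx_inv sS !mulmxA mulmxKV.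
have -> : \tr ((c^-1 *: (invmx S *m z))^T *m S *m z) = c^-1 * qform 1%:M z.
  rewrite linearZ /= trmx_mul trmx_inv sS -!scalemxAl linearZ /= mulmxKV //.
  by rewrite qformE mulmx1.
have : c^-1 ^+ 2 * qform (invmx S) z <= c^-1 * qform 1%:M z.
  rewrite expr2 -mulrA ler_wpM2l ?invr_ge0 ?(ltW c0) //.
  rewrite ler_pdivrMl //; exact: le_trans (ler_norm _) (hc z).
lra.
Qed.

End QuadraticForms.

(** * The Lyapunov equation for a negative definite matrix *)

Section NegativeDefiniteLyapunov.
Variables (R : realType) (n : nat).
Implicit Types (B C Q X : 'M[R]_n).

Lemma negdef_unitmx B : negdef B -> B \in unitmx.
Proof.
move=> nB; rewrite -row_free_unit -kermx_eq0; apply/rowV0P => v /sub_kermxP vB.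
apply/eqP; apply: contraT => v0; have := nB v^T.
rewrite -(inj_eq (@trmx_inj _ _ _)) trmxK trmx0 v0 => /(_ isT).
by rewrite qformE trmxK vB mul0mx mxtrace0 ltxx.
Qed.

Lemma mxtrace_congr B X : \tr (X^T *m B *m X) = \sum_j qform B (col j X).
Proof.
rewrite /mxtrace; apply: eq_bigr => j _.
by rewrite /qform tr_col -row_mul !mxE; apply: eq_bigr => k _; rewrite !mxE.
Qed.

Lemma mxtrace_congr_le0 B X : negdef B -> \tr (X^T *m B *m X) <= 0.
Proof.
move=> nB; rewrite mxtrace_congr; apply: sumr_le0 => j _.
by have [->|/nB/ltW//] := eqVneq (col j X) 0; rewrite qform0.
Qed.

Lemma mxtrace_congr_eq0 B X : negdef B -> \tr (X^T *m B *m X) = 0 -> X = 0.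
Proof.
move=> nB h.
have le0 j : 0 <= - qform B (col j X).
  rewrite oppr_ge0.
  by have [->|/nB/ltW//] := eqVneq (col j X) 0; rewrite qform0.
have /psumr_eq0P h0 : \sum_j - qform B (col j X) = 0.
  by rewrite sumrN -mxtrace_congr h oppr0.
apply/matrixP => i j; suff /colP/(_ i) : col j X = 0 by rewrite !mxE.
by apply/eqP; apply: contraT => /nB; rewrite -oppr_gt0 h0 ?ltxx.
Qed.

Lemma lyapunov_inj B X : negdef B -> B *m X + X *m B = 0 -> X = 0.
Proof.
move=> nB /(congr1 (fun M => \tr (X^T *m M))).
rewrite mulmx0 mxtrace0 mulmxDr raddfD /= mulmxA [in X in _ + X]mulmxA.
(* By cyclicity the second term is [\tr (X *m B *m X^T)]. Both terms are nonpositive with sum 0, so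
   the first vanishes. *)
rewrite (mxtrace_mulC (X^T *m X) B) => h.
apply: (mxtrace_congr_eq0 nB); have := mxtrace_congr_le0 X nB.
have := mxtrace_congr_le0 X^T nB.
rewrite trmxK -[X *m B *m _]mulmxA mxtrace_mulC -[B *m _ *m _]mulmxA; lra.
Qed.

(** An injective endomorphism of a finite-dimensional space is onto; [M] is the matrix of the
    operator on vectorised matrices. *)
Lemma lyapunov_surj B C : negdef B -> exists X, B *m X + X *m B = C.
Proof.
move=> nB; pose M := lin_mx (mulmx B) + lin_mx (mulmxr B).
have ME X : mxvec X *m M = mxvec (B *m X + X *m B).
  by rewrite mulmxDr !mul_vec_lin /= linearD.
have uM : M \in unitmx.
  rewrite -row_free_unit -kermx_eq0; apply/rowV0P => v /sub_kermxP.
  rewrite -[v]vec_mxK ME => /(congr1 vec_mx); rewrite mxvecK linear0.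
  by move/(lyapunov_inj nB) => ->; rewrite linear0.
exists (vec_mx (mxvec C *m invmx M)); apply: (can_inj mxvecK).
by rewrite -ME vec_mxK mulmxKV.
Qed.

(** [X^T] solves the same equation, so injectivity applies to [X^T - X]. *)
Lemma lyapunov_sym B C X : negdef B -> B^T = B -> C^T = C ->
  B *m X + X *m B = C -> X^T = X.
Proof.
move=> nB sB sC h; apply/eqP; rewrite -subr_eq0; apply/eqP.
apply: (lyapunov_inj nB); rewrite mulmxBr mulmxBl addrACA -opprD h.
by apply/eqP; rewrite subr_eq0 -sC -h raddfD /= !trmx_mul sB addrC.
Qed.

(* If the least shift [t] making [X + t *: 1] positive semidefinite were
   positive, the shifted equation would have a negative definite combination on
   its right-hand side, forcing [X + t *: 1] to be invertible, hence coercive,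
   so that [t] could be lowered. *)
Lemma lyapunov_psd B Q X : negdef B -> psd Q -> X^T = X -> B^T = B ->
  B *m X + X *m B = - Q -> psd X.
Proof.
move=> nB [sQ Q0] sX sB h; split=> //.
pose shifted t := X + t *: 1%:M.
have qshift t z : qform (shifted t) z = qform X z + t * qform 1%:M z.
  by rewrite qformD qformZ.
pose E : set R :=
  [set t | 0 <= t /\ forall z, 0 <= qform (shifted t) z]%classic.
have E0 : (E !=set0)%classic.
  have [c c0 hc] := qform_bounded X; exists c; split=> [|z]; first exact: ltW.
  by rewrite qshift; have := hc z; rewrite ler_norml => /andP[]; lra.
have lbE : has_lbound E by exists 0 => t [].
(* The infimum is attained: for each nonzero [z], positivity reads
   [t >= - qform X z / qform 1%:M z], a lower bound that passes to [inf E]. *)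
have Einf : E (inf E).
  split=> [|z]; first by apply: lb_le_inf => // t [].
  have [->|z0] := eqVneq z 0; first by rewrite qform0.
  rewrite qshift -lerBlDl sub0r -ler_pdivrMr ?qform1_gt0 //.
  apply: lb_le_inf => // t [_ /(_ z)]; rewrite qshift.
  rewrite ler_pdivrMr ?qform1_gt0 //; lra.
have [t0 Et] := Einf; set t := inf E in t0 Et Einf.
have [t_gt0|t_le0] := ltP 0 t; last first.
  move=> z; have := Et z; rewrite qshift.
  have -> : t = 0 by apply/eqP; rewrite eq_le t_le0 t0.
  by rewrite mul0r addr0.
have sN : (shifted t)^T = shifted t.
  by rewrite /shifted linearD linearZ /= sX trmx1.
have uN : shifted t \in unitmx.
  rewrite -row_free_unit -kermx_eq0; apply/rowV0P => v /sub_kermxP vN.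
  apply/eqP; apply: contraT => v0.
  have Nv : shifted t *m v^T = 0 by rewrite -sN -trmx_mul vN trmx0.
  have vT0 : v^T != 0 by rewrite -(inj_eq (@trmx_inj _ _ _)) trmxK trmx0.
  (* At a kernel vector of [shifted t] the left side has form value 0, while the right side is
     negative because [t > 0]. *)
  have : B *m shifted t + shifted t *m B = - Q + (2 * t) *: B.
    rewrite mulmxDr mulmxDl addrACA h -scalemxAr -scalemxAl mulmx1 mul1mx.
    by rewrite -scalerDl mulr_natl mulr2n.
  move/(congr1 (fun M => qform M v^T)).
  rewrite [RHS]qformD [in RHS]qformN qformZ.
  rewrite [LHS]qformE trmxK mulmxDr mulmxDl !mulmxA vN mul0mx -!mulmxA.
  rewrite mul0mx Nv !mulmx0 addr0 mxtrace0.
  have := nB _ vT0; have := Q0 v^T => q b.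
  have : t * qform B v^T < 0 by rewrite pmulr_rlt0.
  lra.
have [e e0 he] := psd_unit_coercive (conj sN Et) uN.
(* The bound by [e] preserves positivity of the form; the bound by [t] keeps [t - d] nonnegative. *)
pose d := Num.min e t.
have d0 : 0 < d by rewrite lt_min e0.
have /(ge_inf lbE) : E (t - d).
  split=> [|z]; first by rewrite subr_ge0 ge_min lexx orbT.
  have : d * qform 1%:M z <= e * qform 1%:M z.
    by rewrite ler_wpM2r ?qform1_ge0 // ge_min lexx.
  by have := he z; rewrite !qshift; lra.
rewrite -/t; lra.
Qed.

End NegativeDefiniteLyapunov.

(** * Reduction from [A] to [B = A - J] *)

Section LyapunovOnesPerp.
Variables (R : realType) (n : nat).
Hypothesis n_gt0 : (0 < n)%N.
Implicit Types (P X : 'M[R]_n) (z : 'cV[R]_n).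

(** The orthogonal projection [J] onto the line spanned by [ones]. *)
Definition avgmx : 'M[R]_n := n%:R^-1 *: (ones *m ones^T).

Let n_neq0 : n%:R != 0 :> R. Proof. by rewrite pnatr_eq0 -lt0n. Qed.

Lemma onesT_mul_ones : (@ones R n)^T *m ones = n%:R%:M.
Proof.
apply/rowP => i; rewrite !ord1 !mxE eqxx mulr1n.
under eq_bigr do rewrite !mxE mulr1.
by rewrite sumr_const card_ord.
Qed.

Lemma ones_neq0 : (@ones R n) != 0.
Proof.
apply/eqP => /(congr1 (fun v : 'cV_n => v (Ordinal n_gt0) 0)).
by rewrite !mxE => /eqP; rewrite oner_eq0.
Qed.

Lemma avgmx_sym : avgmx^T = avgmx.
Proof. by rewrite /avgmx linearZ /= trmx_mul trmxK. Qed.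

Lemma avgmx_ones : avgmx *m ones = ones.
Proof.
rewrite -scalemxAl -mulmxA onesT_mul_ones mul_mx_scalar.
by rewrite scalerA mulVf ?scale1r.
Qed.

Lemma avgmx_idem : avgmx *m avgmx = avgmx.
Proof. by rewrite {2}/avgmx -scalemxAr mulmxA avgmx_ones. Qed.

Lemma mxtrace_avgmx : \tr avgmx = 1.
Proof.
rewrite mxtraceZ mxtrace_mulC onesT_mul_ones /mxtrace big_ord1 mxE mulr1n.
by rewrite mulVf.
Qed.

Lemma mulmx_avgmx m (S : 'M[R]_(m, n)) : S *m ones = 0 -> S *m avgmx = 0.
Proof. by move=> S1; rewrite -scalemxAr mulmxA S1 mul0mx scaler0. Qed.

Lemma avgmx_mulmx (S : 'M[R]_n) : S^T = S -> S *m ones = 0 -> avgmx *m S = 0.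
Proof.
by move=> sS S1; rewrite -avgmx_sym -sS -trmx_mul mulmx_avgmx ?trmx0.
Qed.

(** [J] has rank one, so only the scalar [ones^T *m P *m ones] survives between the two outer
    factors. *)
Lemma avgmx_congr P : avgmx *m P *m avgmx = \tr (avgmx *m P) *: avgmx.
Proof.
have e : ones^T *m P *m ones = (\tr (ones *m (ones^T *m P)))%:M.
  by rewrite [LHS]mx11_scalar (mxtrace_mulC ones) /mxtrace big_ord1.
rewrite /avgmx -!scalemxAl -scalemxAr mxtraceZ.
have -> : ones *m ones^T *m P *m (ones *m ones^T)
    = \tr (ones *m ones^T *m P) *: (ones *m ones^T) :> 'M[R]_n.
  rewrite mulmxA -[ones *m _ *m P]mulmxA -[ones *m (_ *m P) *m _]mulmxA e.
  by rewrite mul_mx_scalar -scalemxAl.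
by rewrite !scalerA mulrAC.
Qed.

Lemma qform_avgmx z : qform avgmx z = qform 1%:M (avgmx *m z).
Proof.
rewrite !qformE mulmx1 trmx_mul avgmx_sym !mulmxA.
by rewrite -[_ *m avgmx *m avgmx]mulmxA avgmx_idem.
Qed.

Lemma avgmx_perp z : in_ones_perp (z - avgmx *m z).
Proof.
rewrite /in_ones_perp linearB /= trmx_mul avgmx_sym mulmxBl -mulmxA.
by rewrite avgmx_ones subrr.
Qed.

Lemma qform_perp (S : 'M[R]_n) z : S^T = S -> S *m ones = 0 ->
  qform S (z - avgmx *m z) = qform S z.
Proof.
move=> sS S1; rewrite !qformE -!mulmxA mulmxBr [S *m (_ *m z)]mulmxA.
rewrite mulmx_avgmx // mul0mx subr0 [(z - _)^T]linearB /= trmx_mul avgmx_sym mulmxBl.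
rewrite -mulmxA [avgmx *m _]mulmxA avgmx_mulmx //.
by rewrite mul0mx mulmx0 subr0.
Qed.

Lemma psd_on_perp_psd (S : 'M[R]_n) :
  S^T = S -> S *m ones = 0 -> psd_on_perp S -> psd S.
Proof.
move=> sS S1 pS; split=> // z; rewrite -qform_perp //.
have [->|y0] := eqVneq (z - avgmx *m z) 0; first by rewrite qform0.
exact: pS (avgmx_perp z) y0.
Qed.

Lemma mxtrace_avgmx_line c X :
  X *m ones = 0 -> \tr (avgmx *m (c *: avgmx + X)) = c.
Proof.
move=> X1; rewrite mulmxDr mxtraceD -scalemxAr avgmx_idem mxtraceZ.
by rewrite mxtrace_avgmx mulr1 mxtrace_mulC mulmx_avgmx // mxtrace0 addr0.
Qed.

Variables A Q : 'M[R]_n.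
Hypotheses (sA : A^T = A) (sQ : Q^T = Q).
Hypotheses (A1 : A *m ones = 0) (Q1 : Q *m ones = 0).
Hypothesis nA : negdef_on_perp A.

Let B : 'M[R]_n := A - avgmx.

(** With [y = z - J z], the form at [z] is [qform A y - |J z|^2]. If [y = 0], then [J z = z] is
    nonzero and the second term is strictly negative. *)
Lemma negdef_subr_avgmx : negdef B.
Proof.
move=> z z0; rewrite qformD qformN qform_avgmx -(qform_perp z sA A1).
have [y0|/(nA (avgmx_perp z)) yA] := eqVneq (z - avgmx *m z) 0.
  by rewrite y0 qform0 -(subr0_eq y0) sub0r oppr_lt0 qform1_gt0.
by have := qform1_ge0 (avgmx *m z); lra.
Qed.

Let uB : B \in unitmx. Proof. exact: negdef_unitmx negdef_subr_avgmx. Qed.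

Let sB : B^T = B. Proof. by rewrite /B linearB /= sA avgmx_sym. Qed.

Let B_ones : B *m ones = - ones.
Proof. by rewrite mulmxBl A1 avgmx_ones sub0r. Qed.

Let B_avgmx : B *m avgmx = - avgmx.
Proof. by rewrite mulmxBl mulmx_avgmx // avgmx_idem sub0r. Qed.

Let avgmx_B : avgmx *m B = - avgmx.
Proof. by rewrite mulmxBr avgmx_mulmx // avgmx_idem sub0r. Qed.

(** Since [B J = - J], [B (M - J M) = A M = 0], and [B] is invertible: the kernel of [A] is the line
    of [ones]. *)
Lemma ker_avgmx m (M : 'M[R]_(n, m)) : A *m M = 0 -> avgmx *m M = M.
Proof.
move=> AM; apply/eqP; rewrite eq_sym -subr_eq0 -[_ - _](mulKmx uB) mulmxBr.
by rewrite mulmxA B_avgmx mulNmx opprK mulmxBl AM sub0r addNr mulmx0.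
Qed.

(** [J] commutes with [B^-1] with product [- J], so both products of [A] with [B^-1 + J] equal the
    symmetric projection [1 - J]. *)
Lemma mp_inverse_subr_avgmx : mp_inverse A = invmx B + avgmx.
Proof.
apply: penrose_unique (mp_inverseP A) _.
have AE : A = B + avgmx by rewrite subrK.
have iB_avgmx : invmx B *m avgmx = - avgmx.
  by rewrite -[RHS](mulKmx uB) mulmxN B_avgmx opprK.
have avgmx_iB : avgmx *m invmx B = - avgmx.
  by rewrite -[RHS](mulmxK uB) mulNmx avgmx_B opprK.
have AX : A *m (invmx B + avgmx) = 1%:M - avgmx.
  rewrite {1}AE mulmxDl ![_ *m (_ + avgmx)]mulmxDr mulmxV // B_avgmx.
  by rewrite avgmx_iB avgmx_idem addNr addr0.
have XA : (invmx B + avgmx) *m A = 1%:M - avgmx.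
  rewrite {1}AE mulmxDl ![_ *m (B + _)]mulmxDr mulVmx // avgmx_B.
  by rewrite iB_avgmx avgmx_idem addNr addr0.
apply/and4P; split; apply/eqP.
- by rewrite AX mulmxBl mul1mx avgmx_mulmx // subr0.
- by rewrite XA mulmxBl mul1mx mulmxDr avgmx_iB avgmx_idem addNr subr0.
- by rewrite AX linearB /= trmx1 avgmx_sym.
- by rewrite XA linearB /= trmx1 avgmx_sym.
Qed.

Lemma mxtrace_mp_inverse :
  \tr (Q *m mp_inverse A) = \tr (Q *m invmx B).
Proof.
by rewrite mp_inverse_subr_avgmx mulmxDr (mulmx_avgmx Q1) addr0.
Qed.

Lemma lyapunov_trmx P : lyapunov A Q P -> lyapunov A Q P^T.
Proof.
rewrite /lyapunov => /(congr1 trmx).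
by rewrite linearD linearN /= !trmx_mul trmxK sQ sA addrC.
Qed.

(** Applying the equation to [ones] leaves [A (P ones) = 0]. *)
Lemma lyapunov_ones P : lyapunov A Q P -> avgmx *m (P *m ones) = P *m ones.
Proof.
move=> /(congr1 (mulmx ^~ ones)); rewrite mulmxDl sA -!mulmxA A1 mulmx0 addr0.
by rewrite mulNmx Q1 oppr0 => /ker_avgmx.
Qed.

Lemma lyapunov_avgmx P : lyapunov A Q P ->
  P *m avgmx = avgmx *m P *m avgmx.
Proof.
move/lyapunov_ones => h; rewrite /avgmx -!scalemxAr -/avgmx !mulmxA.
by rewrite -[in RHS](mulmxA avgmx) h.
Qed.

Lemma avgmx_lyapunov P : lyapunov A Q P ->
  avgmx *m P = avgmx *m P *m avgmx.
Proof.
move/lyapunov_trmx/lyapunov_avgmx/(congr1 trmx).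
by rewrite !trmx_mul trmxK avgmx_sym mulmxA.
Qed.

(** After multiplication by [B^-1], each term on the left has trace [\tr X]. *)
Lemma mxtrace_lyapunov X : B *m X + X *m B = - Q ->
  \tr X = - (2^-1 * \tr (Q *m invmx B)).
Proof.
move/(congr1 (fun M => \tr (M *m invmx B))).
rewrite mulmxDl mxtraceD mulmxK // mxtrace_mulC mulKmx // mulNmx raddfN /=; lra.
Qed.

Lemma lyapunov_line : exists X,
  [/\ X *m ones = 0,
      \tr X = - (2^-1 * \tr (Q *m invmx B)),
      psd_on_perp Q -> psd X &
      forall P, lyapunov A Q P <-> exists c, P = c *: avgmx + X].
Proof.
have nB := negdef_subr_avgmx.
have [X BX] := lyapunov_surj (- Q) nB.
have sX : X^T = X by apply: lyapunov_sym nB sB _ BX; rewrite linearN /= sQ.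
have X1 : X *m ones = 0.
  (* As [B ones = - ones], a nonzero [X ones] would be an eigenvector of [B] for the eigenvalue 1,
     against negative definiteness. *)
  have BX1 : B *m (X *m ones) = X *m ones.
    apply/eqP; rewrite -subr_eq0; apply/eqP.
    move/(congr1 (mulmx ^~ ones)): BX; rewrite mulNmx Q1 oppr0 mulmxDl -!mulmxA.
    by rewrite B_ones mulmxN.
  apply/eqP; apply: contraT => v0; have := nB _ v0.
  by rewrite qformE -mulmxA BX1 -[_^T]mulmx1 -qformE ltNge qform1_ge0.
exists X; split=> // [|pQ|P].
- exact: mxtrace_lyapunov.
- exact: lyapunov_psd nB (psd_on_perp_psd sQ Q1 pQ) sX sB BX.
split=> [hP|[c ->]].
  (* Removing the [J] component from [P] turns a solution for [A] into one for [B], which must be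
     [X]. *)
  pose Y := P - avgmx *m P *m avgmx.
  have BY : B *m Y = A *m P.
    rewrite mulmxBr !mulmxA B_avgmx !mulNmx opprK -avgmx_lyapunov //.
    by rewrite -mulmxDl subrK.
  have YB : Y *m B = P *m A.
    rewrite mulmxBl -[_ *m avgmx *m B]mulmxA avgmx_B mulmxN opprK.
    by rewrite -lyapunov_avgmx // -mulmxDr subrK.
  exists (\tr (avgmx *m P)); rewrite -avgmx_congr addrC.
  apply/eqP; rewrite -subr_eq -subr_eq0 -/Y; apply/eqP.
  apply: (lyapunov_inj nB).
  rewrite [B *m _]mulmxBr [_ *m B]mulmxBl addrACA -opprD BX opprK BY YB.
  by move: hP; rewrite /lyapunov sA => ->; rewrite addNr.
rewrite /lyapunov sA mulmxDr mulmxDl -scalemxAr -scalemxAl mulmx_avgmx //.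
rewrite avgmx_mulmx // !scaler0 !add0r -BX mulmxBl mulmxBr.
by rewrite (mulmx_avgmx X1) (avgmx_mulmx sX X1) !subr0.
Qed.

End LyapunovOnesPerp.

(** * The four statements, read off the line of solutions *)

Arguments avgmx {R n}.

Theorem lemma1 (R : realType) (n : nat) (hn : (0 < n)%N) :
  exists p : 'M[R]_n -> R,
  forall A Q : 'M[R]_n,
    A^T = A -> Q^T = Q -> A *m ones = 0 -> Q *m ones = 0 ->
    negdef_on_perp A ->
    [/\
      (* (i) *)
      forall P : 'M[R]_n, lyapunov A Q P ->
        forall a : R, lyapunov A Q (P + a *: (ones *m ones^T)),
      (* (ii) *)
      (forall P : 'M[R]_n, lyapunov A Q P -> psd_on_perp Q ->
         is_eigenvector P ones /\ psd_on_perp P) /\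
      (psd_on_perp Q ->
         (exists! P : 'M[R]_n, min_trace_solution A Q P) /\
         (forall P : 'M[R]_n, min_trace_solution A Q P -> P *m ones = 0)),
      (* (iii); p P depends on P only, and takes every real value on the
         solutions of every equation *)
      (forall P : 'M[R]_n, lyapunov A Q P ->
         \tr P = p P - 2^-1 * \tr (Q *m mp_inverse A) /\
         exists Pperp : 'M[R]_n,
           [/\ P = (p P / n%:R) *: (ones *m ones^T) + Pperp,
               Pperp *m ones = 0 &
               psd_on_perp Q -> psd_on_perp Pperp]) /\
      (forall c : R, exists P : 'M[R]_n, lyapunov A Q P /\ p P = c) &
      (* (iv) *)
      let B := A - n%:R^-1 *: (ones *m ones^T) in
      [/\ B \in unitmx,
          \tr (Q *m mp_inverse A) = \tr (Q *m invmx B) &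
          forall P : 'M[R]_n, lyapunov A Q P ->
            \tr P = p P - 2^-1 * \tr (Q *m invmx B)]].
Proof.
(* The map is fixed before [A] and [Q] are introduced, which expresses its independence of them. *)
exists (fun P => \tr (avgmx *m P)) => A Q sA sQ A1 Q1 nA.
have [X [X1 trX pX solP]] := lyapunov_line hn sA sQ A1 Q1 nA.
have avgE c : (c / n%:R) *: (ones *m ones^T) = c *: avgmx :> 'M[R]_n.
  by rewrite -scalerA.
have trP P : lyapunov A Q P ->
    \tr P = \tr (avgmx *m P) - 2^-1 * \tr (Q *m invmx (A - avgmx)).
  move/solP=> [c ->]; rewrite (mxtrace_avgmx_line hn) //.
  by rewrite mxtraceD mxtraceZ mxtrace_avgmx // mulr1 trX.
(* For [P = c J + X], the form at [ones] is [c |ones|^2] and the trace is [c + \tr X]: positivity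
   gives [c >= 0], and comparison with [X] gives [c <= 0]. *)
have minE P : psd_on_perp Q -> min_trace_solution A Q P <-> P = X.
  move=> pQ; have solX c : lyapunov A Q (c *: avgmx + X) by apply/solP; exists c.
  have solX0 : lyapunov A Q X by rewrite -[X]add0r -(scale0r avgmx).
  split=> [[/solP[c ->] [_ P0] minP]|->].
    have := P0 ones; have := minP X solX0 (pX pQ).
    rewrite mxtraceD mxtraceZ mxtrace_avgmx // mulr1 gerDr => c_le0.
    rewrite qformD qformZ [qform X _]qformE -mulmxA X1 mulmx0 mxtrace0 addr0.
    rewrite qform_avgmx // avgmx_ones // pmulr_lge0 ?qform1_gt0 ?ones_neq0 //.
    move=> c_ge0; have -> : c = 0 by apply/eqP; rewrite eq_le c_le0.
    by rewrite scale0r add0r.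
  split=> // [|P' /solP[c ->] [_ P0]]; first exact: pX.
  have := P0 ones.
  rewrite qformD qformZ [qform X _]qformE -mulmxA X1 mulmx0 mxtrace0 addr0.
  rewrite qform_avgmx // avgmx_ones // pmulr_lge0 ?qform1_gt0 ?ones_neq0 //.
  by rewrite mxtraceD mxtraceZ mxtrace_avgmx // mulr1 lerDr.
split.
(* [ones *m ones^T] is [n J], hence the shift of [c] by [a * n%:R]. *)
- move=> P /solP[c ->] a; apply/solP; exists (c + a * n%:R).
  by rewrite scalerDl addrAC -(avgE (a * _)) mulfK ?pnatr_eq0 -?lt0n.
- split=> [P /solP[c ->] pQ|pQ].
    split.
      split; first exact: ones_neq0.
      by exists c; rewrite mulmxDl X1 addr0 -scalemxAl avgmx_ones.
    move=> z z1 _; rewrite qformD; have [_ X0] := pX pQ.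
    suff -> : qform (c *: avgmx) z = 0 by rewrite add0r.
    rewrite qformZ qformE -scalemxAr mulmxA [z^T *m ones]z1.
    by rewrite mul0mx scaler0 mul0mx mxtrace0 mulr0.
  split; last by move=> P /(minE P pQ) ->.
  by exists X; split=> [|P /(minE P pQ)//]; apply/minE.
- split=> [P lP|c].
    split; first by rewrite mxtrace_mp_inverse // trP.
    exists X; split=> // [|/pX[_ X0] z _ _ //].
    by rewrite avgE; case/solP: lP => c ->; rewrite mxtrace_avgmx_line.
  exists (c *: avgmx + X); split; first by apply/solP; exists c.
  exact: mxtrace_avgmx_line.
- split; first exact: negdef_unitmx (negdef_subr_avgmx hn sA A1 nA).
    exact: mxtrace_mp_inverse.
  exact: trP.
Qed.
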